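(* Let $(E,\mathcal F,\mathcal L)$ be an oriented interval greedoid and $W\subseteq E$. If $\mathrm{res}_W(\alpha)=\alpha|_W$ for all $\alpha\in\mathcal L$, then $(W,\mathcal F|_W,\mathcal L|_W)$ is an oriented interval greedoid, where $\mathcal L|_W=\{\mathrm{res}_W(\alpha):\alpha\in\mathcal L\}$.
   Context: Interval greedoid: finite $E$, nonempty family $\mathcal F$ with (IG1) each nonempty $X\in\mathcal F$ has $x$ with $X\setminus\{x\}\in\mathcal F$; (IG2) if $|X|>|Y|$ there is $x\in X\setminus Y$ with $Y\cup\{x\}\in\mathcal F$; (IG3) if $X\subseteq Y\subseteq Z$ in $\mathcal F$, $e\notin Z$, $X\cup\{e\},Z\cup\{e\}\in\mathcal F$, then $Y\cup\{e\}\in\mathcal F$. $\Gamma(X)=\{x\in E\setminus X:X\cup\{x\}\in\mathcal F\}$; $X\sim Y$ iff $\Gamma(X)=\Gamma(Y)$; classes $[X]$ are flats; $\Phi$ the set of flats ordered by $[X]\le[Y]$ iff there is $Z\subseteq E\setminus Y$ with $Y\cup Z\in\mathcal F$ and $Y\cup Z\sim X$ (a lattice). For a flat $A=[X]$: $\Gamma(A)=\Gamma(X)$, $\xi(A)=\bigcup_{X'\sim X}X'$; $\mu(S)=[X]$ for $X$ inclusion-maximal feasible in $S$; join $A\vee B=\mu(\xi(A)\cap\xi(B))$. A covector is $\alpha:E\to\{0,+,-,1\}$ such that for some flat $A=\mathrm{supp}(\alpha)$, $\alpha\in\{+,-\}$ on $\Gamma(A)$, $0$ on $\xi(A)$, $1$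 elsewhere. Symbols ordered $0<+<1$, $0<-<1$. Product: with $C=\mathrm{supp}\,\alpha\vee\mathrm{supp}\,\beta$, $(\alpha\circ\beta)(e)=\beta(e)$ if $e\in\Gamma(C)\cup\xi(C)$ and $\beta(e)>\alpha(e)$; $\alpha(e)$ if $e\in\Gamma(C)\cup\xi(C)$ otherwise; $1$ otherwise. $-\alpha$ swaps $+,-$; $S(\alpha,\beta)=\{e:\alpha(e)=-\beta(e)\in\{+,-\}\}$. Oriented interval greedoid: $(E,\mathcal F,\mathcal L)$, $\mathcal L$ a set of covectors with (OG1) $\mathrm{supp}:\mathcal L\to\Phi$ surjective; (OG2) $-\mathcal L=\mathcal L$; (OG3) closed under $\circ$; (OG4) if $\alpha,\beta\in\mathcal L$, $x\in S(\alpha,\beta)$, $(\alpha\circ\beta)(x)\ne1$, some $\gamma\in\mathcal L$ has $\gamma(x)=0$ and $\gamma(y)=(\alpha\circ\beta)(y)=(\beta\circ\alpha)(y)$ for all $y\notin S(\alpha,\beta)$ with $(\alpha\circ\beta)(y)\neq1$. Restriction: for $W\subseteq E$, $\mathcal F|_W=\{X\in\mathcal F:X\subseteq W\}$; $(W,\mathcal F|_W)$ is an interval greedoid with its own $\Gamma|_W,\xi|_W,\mu|_W,\Phi|_W$. For $C\in\Phi$ put $C|_W=\mu|_W(W\cap\xi(C))\in\Phi|_W$. For a covector $\alpha$ with $A=\mathrm{supp}(\alpha)$ (one has $\Gamma|_W(A|_W)\subseteq\Gamma(A)$), $\mathrm{res}_W(\alpha):W\to\{0,+,-,1\}$ is $0$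 on $\xi|_W(A|_W)$, equals $\alpha$ on $\Gamma|_W(A|_W)$, and is $1$ elsewhere on $W$. *)

(* Defs.v *)
From HB Require Import structures.
From mathcomp Require Import all_boot.

Set Implicit Arguments.
Unset Strict Implicit.
Unset Printing Implicit Defensive.

(* The ground set of a greedoid is a whole finite type, so that covectors carry
   no junk values; a restriction to W lives on the subtype {x : E | x \in W}. *)

Record interval_greedoid (E : finType) (F : {set {set E}}) : Prop :=
  IntervalGreedoid {
    ig_nonempty : F != set0;
    ig_access : forall X, X \in F -> X != set0 ->
      exists2 x, x \in X & X :\ x \in F;
    ig_exchange : forall X Y, X \in F -> Y \in F -> #|Y| < #|X| ->
      exists2 x, x \in X :\: Y & x |: Y \in F;
    ig_interval : forall (X Y Z : {set E}) (e : E),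
      X \in F -> Y \in F -> Z \in F -> X \subset Y -> Y \subset Z ->
      e \notin Z -> e |: X \in F -> e |: Z \in F -> e |: Y \in F
  }.

Definition cont (E : finType) (F : {set {set E}}) (X : {set E}) : {set E} :=
  [set x | (x \notin X) && (x |: X \in F)].

Definition flat_of (E : finType) (F : {set {set E}}) (X : {set E}) :
    {set {set E}} :=
  [set Y in F | cont F Y == cont F X].

Definition flats (E : finType) (F : {set {set E}}) : {set {set {set E}}} :=
  [set flat_of F X | X in F].

(* All members of a flat have the same continuations, so this union is the
   continuation set of any of them; see flat_cont_of. *)
Definition flat_cont (E : finType) (F : {set {set E}}) (A : {set {set E}}) :
    {set E} :=
  \bigcup_(X in A) cont F X.

Definition xi (E : finType) (A : {set {set E}}) : {set E} :=
  \bigcup_(X in A) X.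

(* The choice of the maximal feasible subset is immaterial, see mu_maxset; the
   default set0 is never used when set0 is feasible. *)
Definition mu (E : finType) (F : {set {set E}}) (S : {set E}) : {set {set E}} :=
  flat_of F (odflt set0
    [pick X | maxset (fun Y : {set E} => (Y \in F) && (Y \subset S)) X]).

Definition flat_join (E : finType) (F : {set {set E}}) (A B : {set {set E}}) :
    {set {set E}} :=
  mu F (xi A :&: xi B).

Inductive symbol : Type := Zero | Plus | Minus | One.

Definition symbol_code (s : symbol) : bool * bool :=
  match s with
  | Zero => (false, false)
  | Plus => (false, true)
  | Minus => (true, false)
  | One => (true, true)
  end.

Definition symbol_decode (c : bool * bool) : symbol :=
  match c with
  | (false, false) => Zero
  | (false, true) => Plus
  | (true, false) => Minus
  | (true, true) => One
  end.

Lemma symbol_codeK : cancel symbol_code symbol_decode.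
Proof. by case. Qed.

HB.instance Definition _ := Countable.copy symbol (can_type symbol_codeK).
HB.instance Definition _ : isFinite symbol := CanIsFinite symbol_codeK.

Definition symbol_lt (s t : symbol) : bool :=
  match s, t with
  | Zero, (Plus | Minus | One) => true
  | (Plus | Minus), One => true
  | _, _ => false
  end.

Definition symbol_opp (s : symbol) : symbol :=
  match s with Plus => Minus | Minus => Plus | _ => s end.

Definition is_sign (s : symbol) : bool := (s == Plus) || (s == Minus).

Definition supported_by (E : finType) (F : {set {set E}}) (A : {set {set E}})
    (a : {ffun E -> symbol}) : bool :=
  [forall e, if e \in flat_cont F A then is_sign (a e)
             else if e \in xi A then a e == Zero
             else a e == One].

Definition covector (E : finType) (F : {set {set E}}) (a : {ffun E -> symbol}) :
    bool :=
  [exists A in flats F, supported_by F A a].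

(* The supporting flat of a covector is unique, see supp_unique; the default
   set0, which is not a flat, is taken only on non-covectors. *)
Definition supp (E : finType) (F : {set {set E}}) (a : {ffun E -> symbol}) :
    {set {set E}} :=
  odflt set0 [pick A in flats F | supported_by F A a].

Definition cprod (E : finType) (F : {set {set E}}) (a b : {ffun E -> symbol}) :
    {ffun E -> symbol} :=
  let C := flat_join F (supp F a) (supp F b) in
  [ffun e => if e \in flat_cont F C :|: xi C then
               (if symbol_lt (a e) (b e) then b e else a e)
             else One].

Definition copp (E : finType) (a : {ffun E -> symbol}) : {ffun E -> symbol} :=
  [ffun e => symbol_opp (a e)].

Definition separation (E : finType) (a b : {ffun E -> symbol}) : {set E} :=
  [set e | is_sign (a e) && (a e == symbol_opp (b e))].

Record oriented_interval_greedoid (E : finType) (F : {set {set E}})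
    (L : {set {ffun E -> symbol}}) : Prop := OrientedIntervalGreedoid {
  oig_greedoid : interval_greedoid F;
  oig_covector : forall a, a \in L -> covector F a;
  oig_supp : forall A, A \in flats F -> exists2 a, a \in L & supp F a = A;
  oig_opp : [set copp a | a in L] = L;
  oig_prod : forall a b, a \in L -> b \in L -> cprod F a b \in L;
  oig_elim : forall a b x, a \in L -> b \in L -> x \in separation a b ->
    cprod F a b x <> One ->
    exists2 c, c \in L &
      c x = Zero /\
      (forall y, y \notin separation a b -> cprod F a b y <> One ->
         c y = cprod F a b y /\ cprod F a b y = cprod F b a y)
}.

Definition restr_feasible (E : finType) (F : {set {set E}}) (W : {set E}) :
    {set {set {x : E | x \in W}}} :=
  [set X : {set {x : E | x \in W}} | [set val w | w in X] \in F].

Definition restr_flat (E : finType) (F : {set {set E}}) (W : {set E})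
    (C : {set {set E}}) : {set {set {x : E | x \in W}}} :=
  mu (restr_feasible F W) [set w : {x : E | x \in W} | val w \in xi C].

Definition res (E : finType) (F : {set {set E}}) (W : {set E})
    (a : {ffun E -> symbol}) : {ffun {x : E | x \in W} -> symbol} :=
  let AW := restr_flat F W (supp F a) in
  [ffun w => if w \in xi AW then Zero
             else if w \in flat_cont (restr_feasible F W) AW then a (val w)
             else One].

Definition restr_fun (E : finType) (W : {set E}) (a : {ffun E -> symbol}) :
    {ffun {x : E | x \in W} -> symbol} :=
  [ffun w => a (val w)].

Lemma flat_cont_of (E : finType) (F : {set {set E}}) (X : {set E}) :
  X \in F -> flat_cont F (flat_of F X) = cont F X.
Proof.
move=> XF; apply/setP=> e; apply/bigcupP/idP => [[Y]|eX].
  by rewrite inE => /andP[_ /eqP->].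
by exists X => //; rewrite inE XF eqxx.
Qed.

Lemma supp_unique (E : finType) (F : {set {set E}}) (A : {set {set E}})
    (a : {ffun E -> symbol}) :
  A \in flats F -> supported_by F A a -> supp F a = A.
Proof.
move=> AF Aa; rewrite /supp; case: pickP => [B /andP[BF Ba]|/(_ A)]; last first.
  by rewrite AF Aa.
have sgnE (D : {set {set E}}) : supported_by F D a ->
    flat_cont F D = [set e | is_sign (a e)].
  move=> /forallP Da; apply/setP=> e; rewrite inE; have:= Da e.
  by case: ifP => [_ ->//|_]; case: ifP => _ /eqP->.
have: flat_cont F B = flat_cont F A by rewrite !sgnE.
case/imsetP: AF => X XF ->; case/imsetP: BF => Y YF -> /=.
by rewrite !flat_cont_of // /flat_of => ->.
Qed.

Lemma mu_maxset (E : finType) (F : {set {set E}}) (S X : {set E}) :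
  interval_greedoid F ->
  maxset (fun Y : {set E} => (Y \in F) && (Y \subset S)) X ->
  mu F S = flat_of F X.
Proof.
move=> gF; pose p (Y : {set E}) := (Y \in F) && (Y \subset S).
have maxU Y x : maxset p Y -> x |: Y \in F -> x \in S -> x \in Y.
  move=> /maxsetP[/andP[_ YS] mY] xF xS.
  have pU : p (x |: Y) by rewrite /p xF subUset sub1set xS.
  by have /setP/(_ x) := mY _ pU (subsetUr _ _); rewrite setU11 => <-.
have le_card X1 X2 : maxset p X1 -> maxset p X2 -> #|X2| <= #|X1|.
  move=> M1 M2; have [/andP[F1 S1] _] := maxsetP M1.
  have [/andP[F2 S2] _] := maxsetP M2; rewrite leqNgt; apply/negP => lt12.
  have [x /setDP[x2 x1] xF] := ig_exchange gF F2 F1 lt12.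
  by rewrite (maxU X1) ?(subsetP S2) in x1.
have sub_cont X1 X2 : maxset p X1 -> maxset p X2 -> cont F X1 \subset cont F X2.
  move=> M1 M2; have le21 := le_card _ _ M1 M2; apply/subsetP=> e.
  have [/andP[F1 S1] _] := maxsetP M1; have [/andP[F2 S2] _] := maxsetP M2.
  rewrite inE => /andP[e1 eF1].
  have [|x] := ig_exchange gF eF1 F2; first by rewrite cardsU1 e1.
  rewrite !inE => /andP[x2 /orP[/eqP xe |x1]] xF; first by rewrite -xe x2 xF.
  by rewrite (maxU X2) ?(subsetP S1) in x2.
move=> MX; rewrite /mu; case: pickP => [Y MY|/(_ X)]; last by rewrite MX.
rewrite /flat_of /=; suff -> : cont F Y = cont F X by [].
by apply/eqP; rewrite eqEsubset !sub_cont.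
Qed.

(* Main.v *)
Require Import Defs.
From mathcomp Require Import all_boot.

(** For a flat A, the feasible sets contained in xi(A) are exactly the subsets
    of members of A that are feasible. A feasible X inside xi(A) has all its
    continuations in Gamma(A) or xi(A), which makes res_W(alpha) a covector
    supported by A|_W. The axiom (IG3) enters through the fact that
    Gamma(X) = Gamma(Y) passes to X+z and Y+z; it gives
    xi(A v B) <= xi(A) /\ xi(B), hence supp(alpha o beta) is the join of the
    supports. Under the hypothesis res_W(alpha) = alpha|_W, one has
    xi_W(A|_W) = W /\ xi(A), so the join commutes with restriction and res_W is
    a homomorphism for the product; the axioms (OG1)-(OG4) then transfer. *)

Set Implicit Arguments.
Unset Strict Implicit.
Unset Printing Implicit Defensive.

Lemma disjoint_notinP (T : finType) (A B : {set T}) :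
  reflect (forall x, x \in A -> x \notin B) [disjoint A & B].
Proof.
by rewrite disjoint_subset; apply: (iffP subsetP) => H x /H; rewrite !inE.
Qed.

(** * Feasible sets and exchange *)

Section IntervalGreedoid.

Variables (E : finType) (F : {set {set E}}).
Hypothesis gF : interval_greedoid F.

Lemma accessible_ind (P : {set E} -> Prop) :
  (set0 \in F -> P set0) ->
  (forall X x, X \in F -> x \in X -> X :\ x \in F -> P (X :\ x) -> P X) ->
  forall X, X \in F -> P X.
Proof.
move=> P0 PS X; have [n] := ubnP #|X|.
elim: n X => // n IHn X ltXn XF; have [X0|nzX] := eqVneq X set0.
  by rewrite X0 in XF *; apply: P0.
have [x xX XxF] := ig_access gF XF nzX.
apply: (PS X x) => //; apply: IHn => //.
by rewrite (cardsD1 x X) xX in ltXn.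
Qed.

Lemma set0_feasible : set0 \in F.
Proof.
have /set0Pn[X XF] := ig_nonempty gF.
by apply: (@accessible_ind (fun=> set0 \in F)) XF.
Qed.

(** Iterating (IG2) draws every added element from [Y], which keeps control over [X] while it grows
    to a prescribed size. *)
Lemma feasible_augment (X Y : {set E}) :
  X \in F -> Y \in F -> #|X| <= #|Y| ->
  exists2 Z, Z \in F & [/\ X \subset Z, Z \subset X :|: Y & #|Z| = #|Y|].
Proof.
move=> XF YF; have [n] := ubnP (#|Y| - #|X|).
elim: n X XF => // n IHn X XF ltn; rewrite leq_eqVlt => /orP[/eqP eqXY|ltXY].
  by exists X; rewrite // subsetUl.
have [x /setDP[xY xX] xF] := ig_exchange gF YF XF ltXY.
have cx : #|x |: X| = #|X|.+1 by rewrite cardsU1 xX.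
have [||Z ZF [XZ ZY cZ]] := IHn _ xF; rewrite ?cx //.
  by rewrite subnS -ltnS prednK ?subn_gt0.
exists Z => //; split=> //; first by rewrite (subset_trans (subsetUr _ _) XZ).
apply: (subset_trans ZY); rewrite subUset subsetUr subUset sub1set.
by rewrite inE xY orbT subsetUl.
Qed.

(** By (IG2), a larger feasible set inside [S] would already supply a one-element extension of [X]
    inside [S]. *)
Lemma maxset_feasibleP (S X : {set E}) :
  reflect [/\ X \in F, X \subset S & [disjoint cont F X & S]]
          (maxset (fun Y : {set E} => (Y \in F) && (Y \subset S)) X).
Proof.
apply: (iffP maxsetP) => [[/andP[XF XS] mX]|[XF XS dXS]].
  split=> //; apply/disjoint_notinP=> e; rewrite inE => /andP[eX eF].
  apply: contra eX => eS.
  by rewrite -(mX (e |: X)) ?setU11 ?subsetUr // eF subUset sub1set eS.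
split=> [|Y /andP[YF YS] XY]; first by rewrite XF.
apply/esym/eqP; rewrite eqEcard XY leqNgt; apply/negP=> ltXY.
have [e /setDP[eY eX] eF] := ig_exchange gF YF XF ltXY.
move/disjoint_notinP/(_ e): dXS; rewrite inE eX eF => /(_ isT)/negP; apply.
exact: (subsetP YS).
Qed.

Lemma feasible_sub_max (S X : {set E}) :
  X \in F -> X \subset S ->
  exists2 Y, [/\ Y \in F, Y \subset S & [disjoint cont F Y & S]] & X \subset Y.
Proof.
move=> XF XS; pose p (Y : {set E}) := (Y \in F) && (Y \subset S).
have pX : p X by rewrite /p XF.
by have [Y /maxset_feasibleP ? ?] := maxset_exists pX; exists Y.
Qed.

Lemma mu_max (S X : {set E}) :
  X \in F -> X \subset S -> [disjoint cont F X & S] -> mu F S = flat_of F X.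
Proof. by move=> XF XS dX; apply: mu_maxset => //; apply/maxset_feasibleP. Qed.

(** * Flats, their continuations and contraction *)

Lemma mem_flat_of (X : {set E}) : X \in F -> X \in flat_of F X.
Proof. by move=> XF; rewrite inE XF eqxx. Qed.

Lemma flat_memP (A : {set {set E}}) (X : {set E}) :
  A \in flats F -> X \in A ->
  [/\ X \in F, flat_cont F A = cont F X & A = flat_of F X].
Proof.
case/imsetP=> Y YF ->; rewrite inE => /andP[XF /eqP eXY].
by split; rewrite ?flat_cont_of // /flat_of eXY.
Qed.

Lemma flat_nonempty (A : {set {set E}}) :
  A \in flats F -> exists X, X \in A.
Proof. by case/imsetP=> X XF ->; exists X; apply: mem_flat_of. Qed.

Lemma flat_cont_notin_xi (A : {set {set E}}) (e : E) :
  A \in flats F -> e \in flat_cont F A -> e \notin xi A.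
Proof.
move=> Aflat eA; apply/negP=> /bigcupP[X XA eX].
by have [_ cA _] := flat_memP Aflat XA; rewrite cA inE eX in eA.
Qed.

Lemma flat_member_max (A : {set {set E}}) (X : {set E}) :
  A \in flats F -> X \in A ->
  [/\ X \in F, X \subset xi A & [disjoint cont F X & xi A]].
Proof.
move=> Aflat XA; have [XF cA _] := flat_memP Aflat XA; split=> //.
  exact: bigcup_sup.
by apply/disjoint_notinP=> e; rewrite -cA => /(flat_cont_notin_xi Aflat).
Qed.

Lemma mu_flat (S : {set E}) : mu F S \in flats F.
Proof.
have [X [XF XS dX] _] := feasible_sub_max set0_feasible (sub0set S).
by rewrite (mu_max XF XS dX); apply: imset_f.
Qed.

Lemma mu_xi (A : {set {set E}}) : A \in flats F -> mu F (xi A) = A.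
Proof.
move=> Aflat; have [X XA] := flat_nonempty Aflat.
have [XF XS dX] := flat_member_max Aflat XA.
by rewrite (mu_max XF XS dX); have [_ _ <-] := flat_memP Aflat XA.
Qed.

Lemma feasible_sub_mu (S X : {set E}) :
  X \in F -> X \subset S -> exists2 Y, Y \in mu F S & X \subset Y.
Proof.
move=> XF XS; have [Y [YF YS dY] XY] := feasible_sub_max XF XS.
by exists Y => //; rewrite (mu_max YF YS dY) mem_flat_of.
Qed.

Lemma feasible_sub_xi (A : {set {set E}}) (X : {set E}) :
  A \in flats F -> X \in F -> X \subset xi A ->
  exists2 Y, Y \in A & X \subset Y.
Proof. by move=> Aflat XF /(feasible_sub_mu XF); rewrite mu_xi. Qed.

(** Extend [X] to a member [Y] of [A]. A continuation [e] of [X] that neither lies in [Y] nor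
    continues it can be traded for an element of [Y], and the result is again a member of [A]. *)
Lemma cont_sub_flat (A : {set {set E}}) (X : {set E}) :
  A \in flats F -> X \in F -> X \subset xi A ->
  cont F X \subset flat_cont F A :|: xi A.
Proof.
move=> Aflat XF XA; apply/subsetP=> e; rewrite 2!inE => /andP[eX eF].
apply/orP; have [Y YA XY] := feasible_sub_xi Aflat XF XA.
have [YF cA eqA] := flat_memP Aflat YA; rewrite cA inE.
have [eY|eY] := boolP (e \in Y); first by right; apply/bigcupP; exists Y.
have [eYF|eYF] := boolP (e |: Y \in F); [by left | right].
(* Equal sizes would force [X = Y] and make [e |: Y] feasible. *)
have le_Y : #|e |: X| <= #|Y|.
  rewrite cardsU1 eX add1n ltn_neqAle subset_leq_card // andbT.
  apply: contraNneq eYF => cXY; suff <- : X = Y by [].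
  by apply/eqP; rewrite eqEcard XY cXY leqnn.
have [Z ZF [eXZ ZeXY cZ]] := feasible_augment eF YF le_Y.
have eZ : e \in Z by rewrite (subsetP eXZ) ?setU11.
have ZeY : Z \subset e |: Y.
  by apply: subset_trans ZeXY _; rewrite -setUA (setUidPr XY).
have YZe u : u |: Z = e |: Y -> u |: Z \notin F by move->.
have cZe u : u \notin Z -> u \in Y -> u |: Z = e |: Y.
  move=> uZ uY; apply/eqP; rewrite eqEcard subUset ZeY sub1set !inE uY orbT /=.
  by rewrite !cardsU1 eY uZ cZ.
(* [Z] is [e |: Y] minus one element of [Y]. In both exchanges below, adding anything but [u] would
   make [e |: Y] feasible, so [Z] and [Y] have the same continuations. *)
apply/bigcupP; exists Z => //; rewrite eqA inE ZF /= eqEsubset.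
apply/andP; split; apply/subsetP=> u; rewrite !inE => /andP[uN uF].
  have [|t] := ig_exchange gF uF YF; first by rewrite cardsU1 uN cZ.
  rewrite !inE => /andP[tY /orP[/eqP <-|/(subsetP ZeY)]] tF; first by rewrite tY.
  rewrite in_setU1 (negPf tY) orbF in tF.
  by rewrite (eqP tF) (negPf eYF).
have [|t] := ig_exchange gF uF ZF; first by rewrite cardsU1 uN cZ.
rewrite !inE => /andP[tZ /orP[/eqP <-|tY]] tF; first by rewrite tZ.
by have := YZe t (cZe t tZ tY); rewrite tF.
Qed.

(** Here [b] is unlocked only by [z], which lies outside [U]. This excludes the unwanted exchange in
    [cont_contract]. *)
Lemma feasible_rank_step (U Z : {set E}) (z b : E) :
  Z \in F -> Z \subset U -> [disjoint cont F Z & U] -> z \notin U ->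
  z |: Z \in F -> b |: (z |: Z) \in F -> b \notin Z -> b \in U ->
  forall Y, Y \in F -> Y \subset U -> b \notin Y.
Proof.
move=> ZF ZU dZ zU zZF bzZF bZ bU.
have maxU V u : V \in F -> V \subset U -> #|V| = #|Z| -> u \in U ->
    u \notin V -> u |: V \notin F.
  move=> VF VU cV uU uV; apply/negP=> uF.
  have [|t] := ig_exchange gF uF ZF; first by rewrite cardsU1 uV cV.
  rewrite in_setD => /andP[tZ tuV] tF.
  have tU : t \in U.
    by case/setU1P: tuV => [->//|/(subsetP VU)].
  by move/disjoint_notinP/(_ t): dZ; rewrite inE tZ tF tU => /(_ isT).
(* Every feasible Y inside U can be moved inside a basis V of U for which b
   still becomes available only after z; (IG3) forbids b from being reached
   inside U. *)
suff step Y : Y \in F -> Y \subset U -> exists2 V, V \in F &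
    [/\ Y \subset V, V \subset U, #|V| = #|Z|, b \notin V
      & b |: (z |: V) \in F].
  move=> Y YF YU; have [V _ [YV _ _ bV _]] := step Y YF YU.
  by apply: contra bV; apply: subsetP.
elim/accessible_ind: Y / => [_ _|{}Y y YF yY YyF IHY YU].
  by exists Z => //; rewrite sub0set.
have [|V VF [YyV VU cV bV bzVF]] := IHY.
  exact: subset_trans (subsetDl _ _) YU.
have yU : y \in U := subsetP YU _ yY.
have [yV|yV] := boolP (y \in V).
  exists V => //; split=> //; rewrite -(setD1K yY) subUset sub1set yV //.
have zV : z \notin V by apply: contra zU; apply: (subsetP VU).
(* Exchange from [z |: Z] into [V'] can add only [z], since [maxU] blocks the elements of [Z]. *)
have aug V' : V' \in F -> V' \subset U -> #|V'| = #|Z| -> z |: V' \in F.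
  move=> V'F V'U cV'; have zZ : z \notin Z.
    by apply: contra zU; apply: (subsetP ZU).
  have [|t] := ig_exchange gF zZF V'F; first by rewrite cardsU1 zZ cV'.
  rewrite !inE => /andP[tV' /orP[/eqP->//|tZ]].
  by rewrite (negPf (maxU _ _ _ _ _ _ tV')) ?(subsetP ZU).
have zVF := aug V VF VU cV.
(* (IG3) along [Y :\ y], [V], [z |: V] with the element [y]: if [y] extended both ends, it would
   extend the basis [V] inside [U]. *)
have yzVN : y |: (z |: V) \notin F.
  apply/negP=> yzVF; case/negP: (maxU V y VF VU cV yU yV).
  apply: (ig_interval gF YyF VF zVF YyV) => //; first exact: subsetUr.
    by rewrite !inE negb_or yV andbT; apply: contraNneq zU => <-.
  by rewrite setD1K.
have yb : y != b by apply: contraNneq yzVN => ->.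
have cYV : #|Y| <= #|V|.
  rewrite leqNgt; apply/negP=> ltVY.
  have [t /setDP[tY tV]] := ig_exchange gF YF VF ltVY.
  by rewrite (negPf (maxU _ _ _ _ _ _ tV)) ?(subsetP YU).
have [V' V'F [YV' V'YV cV']] := feasible_augment YF VF cYV.
have V'yV : V' \subset y |: V.
  apply: subset_trans V'YV _; rewrite -(setD1K yY) -setUA.
  by rewrite (setUidPr YyV).
have V'U : V' \subset U.
  by apply: subset_trans V'yV _; rewrite subUset sub1set yU.
have bV' : b \notin V'.
  by apply: contra bV => /(subsetP V'yV); rewrite !inE eq_sym (negPf yb).
exists V' => //; rewrite cV'; split=> //.
have zV' : z \notin V' by apply: contra zU; apply: (subsetP V'U).
have zV'F : z |: V' \in F by apply: aug; rewrite ?cV'.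
(* The exchange must add [b]: by cardinality, any other element would complete [z |: V'] to
   [y |: (z |: V)], which is infeasible. *)
have [|t] := ig_exchange gF bzVF zV'F.
  by rewrite !cardsU1 !inE negb_or bV zV zV' cV' andbT (contraNneq _ zU) // => <-.
rewrite in_setD => /andP[tzV' /setU1P[->//|]] tzV tF.
have tzy : t |: (z |: V') = y |: (z |: V).
  apply/eqP; rewrite eqEcard; apply/andP; split.
    rewrite !subUset !sub1set !inE eqxx orbT /=.
    move: tzV; rewrite !inE => -> /=; rewrite orbT /=.
    by apply: subset_trans V'yV _; rewrite setUS // subsetUr.
  rewrite !(cardsU1, tzV', zV', zV) cV' /= leq_add2r.
  exact: leq_b1.
by rewrite tzy in tF; rewrite tF in yzVN.
Qed.

(** Exchange carries a continuation of [z |: X] over to [z |: Y] unless some [t] in [X] intervenes.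
    Such a [t] would be reachable over [Y] only after [z], although [X] contains it inside
    [X :|: Y]. *)
Lemma cont_contract (X Y : {set E}) (z : E) :
  X \in F -> Y \in F -> cont F X = cont F Y -> z \in cont F X ->
  cont F (z |: X) = cont F (z |: Y).
Proof.
have card_le X1 X2 : X1 \in F -> X2 \in F -> cont F X1 = cont F X2 ->
    #|X1| <= #|X2|.
  move=> F1 F2 eq12; rewrite leqNgt; apply/negP=> lt21.
  have [t /setDP[t1 t2] tF] := ig_exchange gF F1 F2 lt21.
  by move/setP/(_ t): eq12; rewrite !inE t1 t2 tF.
suff sub X1 X2 : X1 \in F -> X2 \in F -> cont F X1 = cont F X2 ->
    z \in cont F X1 -> cont F (z |: X1) \subset cont F (z |: X2).
  move=> XF YF eqXY zX; apply/eqP; rewrite eqEsubset.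
  by apply/andP; split; apply: sub; rewrite -?eqXY.
move=> F1 F2 eq12 zc1; have zc2 := zc1; rewrite eq12 in zc2.
move: (zc1) (zc2); rewrite !inE => /andP[z1 zF1] /andP[z2 zF2].
apply/subsetP=> w; rewrite 2![_ \in cont _ _]inE => /andP[wz1 wF].
have [|t] := ig_exchange gF wF zF2.
  by rewrite !cardsU1 wz1 z1 z2 !add1n !ltnS; apply: card_le.
rewrite in_setD => /andP[tz2 /setU1P[<-|tm]] tF; first by rewrite tz2.
have tz : t != z by apply: contraNneq tz2 => ->; rewrite setU11.
have t1 : t \in X1 by case/setU1P: tm => // /eqP; rewrite (negPf tz).
have := @feasible_rank_step (X1 :|: X2) X2 z t F2 (subsetUr _ _).
have t2 : t \notin X2 by apply: contra tz2; apply: setU1r.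
rewrite !inE t1 (negPf z1) (negPf z2) => /(_ _ isT zF2 tF t2 isT) H.
(* [X2] is a basis of [X1 :|: X2], because a common continuation avoids both sets. *)
suff dU : [disjoint cont F X2 & X1 :|: X2].
  by have := H dU X1 F1 (subsetUl _ _); rewrite t1.
apply/disjoint_notinP=> u uc2; have uc1 := uc2; rewrite -eq12 in uc1.
by move: uc1 uc2; rewrite !inE => /andP[/negPf-> _] /andP[/negPf->].
Qed.

(** The elements leading from [X] up to a member [Y] of [A] can also be added to any [X'] equivalent
    to [X], by [cont_contract]. The final set contains [X'] and is equivalent to [Y], so it belongs
    to [A]. *)
Lemma xi_flat_of_sub (A : {set {set E}}) (X : {set E}) :
  A \in flats F -> X \in F -> X \subset xi A -> xi (flat_of F X) \subset xi A.
Proof.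
move=> Aflat XF XA; have [Y YA XY] := feasible_sub_xi Aflat XF XA.
have [YF _ eqA] := flat_memP Aflat YA.
apply/bigcupsP=> X'; rewrite inE => /andP[X'F /eqP eqX].
have [n] := ubnP (#|Y| - #|X|).
elim: n X X' XF X'F eqX XY {XA} => // n IHn X X' XF X'F eqX XY ltn.
have [ltXY|leYX] := ltnP #|X| #|Y|; last first.
  have eXY : X = Y by apply/eqP; rewrite eqEcard XY.
  by apply: bigcup_sup; rewrite eqA -eXY inE X'F eqX /=.
have [z /setDP[zY zX] zF] := ig_exchange gF YF XF ltXY.
have zc : z \in cont F X' by rewrite eqX inE zX.
apply: subset_trans (subsetUr [set z] _) (IHn (z |: X) (z |: X') zF _ _ _ _).
- by move: zc; rewrite inE => /andP[].
- exact: cont_contract.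
- by rewrite subUset sub1set zY.
- by rewrite cardsU1 zX add1n subnS -ltnS prednK ?subn_gt0.
Qed.

(** * Joins and supports of products *)

Lemma flat_join_flat (A B : {set {set E}}) : flat_join F A B \in flats F.
Proof. exact: mu_flat. Qed.

Lemma flat_join_memP (A B : {set {set E}}) :
  exists X, [/\ X \in F, X \subset xi A :&: xi B,
    [disjoint cont F X & xi A :&: xi B] & flat_join F A B = flat_of F X].
Proof.
have [X [XF XS dX] _] :=
  feasible_sub_max set0_feasible (sub0set (xi A :&: xi B)).
by exists X; split=> //; apply: mu_max.
Qed.

Lemma xi_flat_join (A B : {set {set E}}) :
  A \in flats F -> B \in flats F -> xi (flat_join F A B) \subset xi A :&: xi B.
Proof.
move=> Af Bf; have [X [XF + _ ->]] := flat_join_memP A B.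
by rewrite !subsetI => /andP[XA XB]; rewrite !xi_flat_of_sub.
Qed.

(** For covectors supported by [A] and [B], neither value at such an [e] is [One] and they are not
    both [Zero], so the product has a sign there. *)
Lemma flat_cont_join (A B : {set {set E}}) (e : E) :
  A \in flats F -> B \in flats F -> e \in flat_cont F (flat_join F A B) ->
  [/\ e \in flat_cont F A :|: xi A, e \in flat_cont F B :|: xi B
    & e \notin xi A :&: xi B].
Proof.
move=> Af Bf; have [X [XF + dX ->]] := flat_join_memP A B.
rewrite flat_cont_of // subsetI => /andP[XA XB] eX; split.
- exact: (subsetP (cont_sub_flat Af XF XA)).
- exact: (subsetP (cont_sub_flat Bf XF XB)).
- by rewrite (disjointFr dX).
Qed.

Lemma suppP (a : {ffun E -> symbol}) :
  covector F a -> supp F a \in flats F /\ supported_by F (supp F a) a.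
Proof.
by case/existsP=> A /andP[Af Aa]; rewrite (supp_unique Af Aa).
Qed.

(** Turns membership in Gamma(A) and xi(A) into case analysis on symbols. *)
Lemma supported_byE (A : {set {set E}}) (a : {ffun E -> symbol}) (e : E) :
  A \in flats F -> supported_by F A a ->
  [/\ is_sign (a e) = (e \in flat_cont F A), (a e == Zero) = (e \in xi A)
    & (a e != One) = (e \in flat_cont F A :|: xi A)].
Proof.
move=> Af /forallP/(_ e); rewrite in_setU.
have := @flat_cont_notin_xi A e Af.
case: (e \in flat_cont F A); first by move=> /(_ isT)/negPf->; case: (a e).
by case: (e \in xi A) => _ /eqP->.
Qed.

Lemma supported_by_cprod (a b : {ffun E -> symbol}) :
  covector F a -> covector F b ->
  supported_by F (flat_join F (supp F a) (supp F b)) (cprod F a b).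
Proof.
move=> /suppP[Af Aa] /suppP[Bf Bb]; apply/forallP=> e; rewrite ffunE in_setU.
have [_ zA nA] := supported_byE e Af Aa; have [_ zB nB] := supported_byE e Bf Bb.
case: (boolP (e \in flat_cont F _)) => [eC|_] /=.
  have [] := flat_cont_join Af Bf eC.
  by rewrite -nA -nB in_setI -zA -zB; case: (a e); case: (b e).
case: (boolP (e \in xi (flat_join _ _ _))) => // eC.
have := subsetP (xi_flat_join Af Bf) e eC.
by rewrite in_setI -zA -zB => /andP[/eqP-> /eqP->].
Qed.

Lemma supp_cprod (a b : {ffun E -> symbol}) :
  covector F a -> covector F b ->
  supp F (cprod F a b) = flat_join F (supp F a) (supp F b).
Proof.
move=> ca cb; apply: supp_unique (flat_join_flat _ _) _.
exact: supported_by_cprod.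
Qed.

End IntervalGreedoid.

(** * Restriction of flats and covectors to [W] *)

Section Restriction.

Variables (E : finType) (F : {set {set E}}) (W : {set E}).
Hypothesis gF : interval_greedoid F.

Local Notation T := {x : E | x \in W}.
Local Notation FW := (restr_feasible F W).

Lemma imset_valU1 (x : T) (X : {set T}) :
  val @: (x |: X) = val x |: val @: X :> {set E}.
Proof. by rewrite imsetU1. Qed.

Lemma mem_imset_val (x : T) (X : {set T}) : (val x \in val @: X) = (x \in X).
Proof. exact: mem_imset val_inj. Qed.

Lemma restr_interval_greedoid : interval_greedoid FW.
Proof.
split.
- by apply/set0Pn; exists set0; rewrite inE imset0 set0_feasible.
- move=> X; rewrite inE => XF /set0Pn[w wX].
  have [|x xX XxF] := ig_access gF XF.
    by apply/set0Pn; exists (val w); rewrite mem_imset_val.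
  case/imsetP: xX XxF => y yX -> XyF; exists y => //; rewrite inE.
  by move: XyF; rewrite -{1}(setD1K yX) imset_valU1 setU1K // mem_imset_val setD11.
- move=> X Y; rewrite !inE => XF YF ltYX.
  have [|x] := ig_exchange gF XF YF; first by rewrite !(card_imset _ val_inj).
  case/setDP=> /imsetP[y yX ->]; rewrite mem_imset_val => yY yF.
  by exists y; rewrite inE ?yX ?yY // imset_valU1.
- move=> X Y Z e; rewrite !inE !imset_valU1 => XF YF ZF XY YZ eZ.
  by apply: (ig_interval gF XF YF ZF); rewrite ?imsetS ?mem_imset_val.
Qed.

Local Notation gFW := restr_interval_greedoid.

Lemma mem_restr_cont (X : {set T}) (w : T) :
  (w \in cont FW X) = (val w \in cont F (val @: X)).
Proof. by rewrite !inE imset_valU1 mem_imset_val. Qed.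

Lemma restr_flat_flat (A : {set {set E}}) : restr_flat F W A \in flats FW.
Proof. exact: (mu_flat gFW). Qed.

(** By [cont_sub_flat], a continuation of a maximal feasible subset of W within xi(A) lies in
    Gamma(A) or xi(A); maximality rules out xi(A). *)
Lemma restr_flat_cont (A : {set {set E}}) (w : T) :
  A \in flats F -> w \in flat_cont FW (restr_flat F W A) ->
  val w \in flat_cont F A.
Proof.
move=> Af; pose S := [set w : T | val w \in xi A].
have [X [XF XS dX] _] := feasible_sub_max gFW (set0_feasible gFW) (sub0set S).
rewrite /restr_flat (mu_max gFW XF XS dX) flat_cont_of // => wX.
have := disjointFr dX wX; rewrite inE => wA.
have := @cont_sub_flat _ _ gF A (val @: X) Af.
rewrite inE in XF; move=> /(_ XF) H.
have {}H : cont F (val @: X) \subset flat_cont F A :|: xi A.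
  apply: H; apply/subsetP=> _ /imsetP[y yX ->].
  by have := subsetP XS y yX; rewrite inE.
by move: wX; rewrite mem_restr_cont => /(subsetP H); rewrite in_setU wA orbF.
Qed.

(** Lifts each flat of the restriction to a flat of [F], as (OG1) requires: [X] has no continuation
    in the xi of its own flat, hence none in the part inside W. *)
Lemma restr_flat_of (X : {set T}) :
  X \in FW -> restr_flat F W (flat_of F (val @: X)) = flat_of FW X.
Proof.
move=> XW; have XF := XW; rewrite inE in XF.
have Af : flat_of F (val @: X) \in flats F by apply: imset_f.
have [_ XA dX] := flat_member_max Af (mem_flat_of XF).
apply: (mu_max gFW) => //.
  by apply/subsetP=> w wX; rewrite inE (subsetP XA) ?mem_imset_val.
apply/disjoint_notinP=> w; rewrite mem_restr_cont [w \in _]in_set.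
exact: (disjoint_notinP _ _ dX).
Qed.

Lemma supported_by_res (a : {ffun E -> symbol}) :
  covector F a -> supported_by FW (restr_flat F W (supp F a)) (res F W a).
Proof.
case/suppP=> Af Aa; apply/forallP=> w; rewrite ffunE.
have [sA _ _] := supported_byE (val w) Af Aa.
case: (boolP (w \in flat_cont _ _)) => [wC|_]; last by case: (w \in xi _).
rewrite (negPf (flat_cont_notin_xi (restr_flat_flat _) wC)) sA.
exact: restr_flat_cont.
Qed.

Lemma covector_res (a : {ffun E -> symbol}) :
  covector F a -> covector FW (res F W a).
Proof.
move=> ca; apply/existsP; exists (restr_flat F W (supp F a)).
by rewrite restr_flat_flat supported_by_res.
Qed.

Lemma supp_res (a : {ffun E -> symbol}) :
  covector F a -> supp FW (res F W a) = restr_flat F W (supp F a).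
Proof.
move=> ca; apply: supp_unique (restr_flat_flat _) _; exact: supported_by_res.
Qed.

(** The two sides are the zero sets of [res F W a] and of [a]. *)
Lemma xi_restr_supp (a : {ffun E -> symbol}) (w : T) :
  covector F a -> res F W a = restr_fun W a ->
  (w \in xi (restr_flat F W (supp F a))) = (val w \in xi (supp F a)).
Proof.
move=> ca ra; have [Af Aa] := suppP ca.
have [_ <- _] := supported_byE w (restr_flat_flat _) (supported_by_res ca).
by have [_ <- _] := supported_byE (val w) Af Aa; rewrite ra ffunE.
Qed.

(** A maximal feasible subset of [S] extends in [F] to a member of the join. It therefore lies in
    the xi of the join, and it stays maximal there because [xi_flat_join] puts that set inside xi(A)
    and xi(B). *)
Lemma restr_flat_join (A B : {set {set E}}) :
  A \in flats F -> B \in flats F ->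
  restr_flat F W (flat_join F A B)
    = mu FW [set w : T | val w \in xi A :&: xi B].
Proof.
move=> Af Bf; set S := [set w : T | val w \in xi A :&: xi B].
have [X [XF XS dX] _] := feasible_sub_max gFW (set0_feasible gFW) (sub0set S).
rewrite (mu_max gFW XF XS dX); apply: (mu_max gFW) => //.
  have [||Y Yin XY] := @feasible_sub_mu _ F gF (xi A :&: xi B) (val @: X).
  - by rewrite inE in XF.
  - apply/subsetP=> _ /imsetP[y yX ->].
    by have := subsetP XS y yX; rewrite inE.
  apply/subsetP=> w wX; rewrite inE; apply/bigcupP; exists Y => //.
  by apply: (subsetP XY); rewrite mem_imset_val.
apply: disjointWr dX; apply/subsetP=> w; rewrite !in_set => wC.
by have := subsetP (xi_flat_join gF Af Bf) _ wC; rewrite in_setI.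
Qed.

Lemma cprod_res (a b : {ffun E -> symbol}) :
  covector F a -> covector F b ->
  res F W a = restr_fun W a -> res F W b = restr_fun W b ->
  res F W (cprod F a b) = restr_fun W (cprod F a b) ->
  cprod FW (res F W a) (res F W b) = res F W (cprod F a b).
Proof.
move=> ca cb ra rb rab; have [Af Aa] := suppP ca; have [Bf Bb] := suppP cb.
have cab : covector F (cprod F a b).
  apply/existsP; exists (flat_join F (supp F a) (supp F b)).
  by rewrite flat_join_flat // supported_by_cprod.
have joinE : flat_join FW (supp FW (res F W a)) (supp FW (res F W b))
    = restr_flat F W (flat_join F (supp F a) (supp F b)).
  rewrite (supp_res ca) (supp_res cb) (restr_flat_join Af Bf) /flat_join.
  congr (mu _ _); apply/setP=> w.
  rewrite [RHS]in_set [RHS]in_setI [LHS]in_setI.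
  by congr (_ && _); [apply: xi_restr_supp ca ra | apply: xi_restr_supp cb rb].
apply/ffunP=> w; rewrite ffunE joinE -supp_cprod //.
(* The membership test of the product over [W] becomes the test whether the product over [E] differs
   from [One]. When it does, the test over [E] succeeded too and both products compare the same
   values. *)
have [_ _ <-] := supported_byE w (restr_flat_flat _) (supported_by_res cab).
case: eqP => [->//|]; rewrite rab ra rb !ffunE /=.
by case: ifP.
Qed.

End Restriction.

(** * Transfer of (OG1)-(OG4) to the restriction *)

Theorem mainTheorem11 (E : finType) (F : {set {set E}})
    (L : {set {ffun E -> symbol}}) (W : {set E}) :
  oriented_interval_greedoid F L ->
  (forall a, a \in L -> res F W a = restr_fun W a) ->
  oriented_interval_greedoid (restr_feasible F W) [set res F W a | a in L].
Proof.
case=> gF covL suppL oppL prodL elimL resL.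
have prod_res a b : a \in L -> b \in L ->
    cprod (restr_feasible F W) (res F W a) (res F W b) = res F W (cprod F a b).
  by move=> aL bL; apply: cprod_res; rewrite ?covL ?resL ?prodL.
have copp_res a : a \in L -> copp a \in L /\ copp (res F W a) = res F W (copp a).
  move=> aL; have caL : copp a \in L by rewrite -oppL imset_f.
  by split; rewrite // !resL //; apply/ffunP=> w; rewrite !ffunE.
have copp_sub (b : {ffun _ -> symbol}) : b \in [set res F W a | a in L] ->
    copp b \in [set res F W a | a in L].
  by case/imsetP=> a /copp_res[caL] + ->; move=> ->; apply: imset_f.
split.
- exact: restr_interval_greedoid.
- by move=> _ /imsetP[a aL ->]; apply: covector_res; rewrite ?covL.
- move=> _ /imsetP[X XW ->]; have XF := XW; rewrite inE in XF.
  have [|a aL supp_a] := suppL (flat_of F (val @: X)); first exact: imset_f.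
  exists (res F W a); first exact: imset_f.
  by rewrite supp_res ?covL // supp_a restr_flat_of.
- apply/setP=> b; apply/imsetP/idP => [[c cL ->]|bL]; first exact: copp_sub.
  exists (copp b); first exact: copp_sub.
  by apply/ffunP=> w; rewrite !ffunE; case: (b w).
- move=> _ _ /imsetP[a aL ->] /imsetP[b bL ->].
  by rewrite prod_res ?imset_f ?prodL.
- move=> _ _ x /imsetP[a aL ->] /imsetP[b bL ->].
  have restr_funE f y : restr_fun W f y = f (val y) by rewrite ffunE.
  rewrite !prod_res // !resL ?prodL // restr_funE => xS x1.
  have sepE y : (y \in separation (restr_fun W a) (restr_fun W b))
      = (val y \in separation a b) by rewrite !inE !restr_funE.
  (* Products and separation sets over [W] are now plain restrictions, so it suffices to eliminate
     at [val x] in [L] and restrict [c]. *)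
  rewrite sepE in xS; have [c cL [cx cE]] := elimL a b _ aL bL xS x1.
  exists (res F W c); first exact: imset_f.
  by rewrite resL // restr_funE; split=> // y; rewrite sepE !restr_funE; apply: cE.
Qed.
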